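(* Let $V$ be a finite-dimensional vector space over the field $K = GF(2)$ and let $f : V \to V$ be a nilpotent $K$-linear map. The following statements are equivalent. (i) There exists a characteristic subspace of $V$ (with respect to $f$) which is not hyperinvariant (with respect to $f$). (ii) For some numbers $r$ and $s$ with $s > r + 1$ the Jordan form of $f$ contains exactly one Jordan block of size $s$ and exactly one Jordan block of size $r$.
   Context: A subspace $X \subseteq V$ is $f$-invariant if $f(X) \subseteq X$. A subspace $X$ is called hyperinvariant (for $f$) if $X$ is invariant under all endomorphisms of $V$ that commute with $f$. An $f$-invariant subspace $X$ is called characteristic (for $f$) if $\alpha(X) = X$ for all $K$-automorphisms $\alpha$ of $V$ that commute with $f$. In (ii), $r$ and $s$ are positive integers (sizes of Jordan blocks). *)

(* Defs.v *)
From HB Require Import structures.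
From mathcomp Require Import all_boot all_order all_algebra.

Set Implicit Arguments.
Unset Strict Implicit.
Unset Printing Implicit Defensive.

Import GRing.Theory.
Local Open Scope ring_scope.

Section Definitions.

Variables (K : fieldType) (V : vectType K).
Implicit Types (f g alpha : 'End(V)) (X : {vspace V}).

(* 'End(V) is a ring only for nontrivial V, so powers are taken with iter. *)
Definition nilpotent_end f := exists n : nat, forall v : V, iter n f v = 0.

Definition commute_end g f := (g \o f)%VF = (f \o g)%VF.

Definition invariant_vs f X := (f @: X <= X)%VS.

Definition hyperinvariant_vs f X :=
  forall g, commute_end g f -> invariant_vs g X.

Definition characteristic_vs f X :=
  invariant_vs f X /\
  forall alpha, bijective alpha -> commute_end alpha f -> (alpha @: X)%VS = X.

Definition jordan_block (a : K) (n : nat) : 'M[K]_n :=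
  a%:M + \matrix_(i < n, j < n) (i.+1 == j)%:R.

(* Textbook convention: column j of the matrix holds the coordinates of f e_j. *)
Definition represents (n : nat) (M : 'M[K]_n) (e : n.-tuple V) f :=
  forall j : 'I_n, f e`_j = \sum_(i < n) M i j *: e`_i.

(* The Jordan form is unique only up to the order of the blocks, hence a
   predicate rather than a function of f. *)
Definition has_jordan_form f (k : nat) (a : 'I_k -> K) (p : 'I_k -> nat) :=
  (forall i, (0 < p i)%N) /\
  exists e : (\sum_(i < k) p i).-tuple V,
    basis_of fullv e /\
    represents (\mxdiag_(i < k) jordan_block (a i) (p i)) e f.

End Definitions.

(* Main.v *)
Require Import Defs.
From HB Require Import structures.
From mathcomp Require Import all_boot all_order all_algebra.
From mathcomp Require Import zify.
Import GRing.Theory.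
Local Open Scope ring_scope.

Set Implicit Arguments.
Unset Strict Implicit.
Unset Printing Implicit Defensive.

(** View V as a module over K[x], with x acting as f. A Jordan basis
    decomposes V into cyclic summands (chains), one for each block, generated by
    u_i with annihilator x^(p_i); write pi_i for the projection onto the chain
    of u_i. The maps that commute with f are the module endomorphisms, and one
    can be prescribed by sending each u_i to any vector killed by f^(p_i). The
    predicate [jordan_generators] records this universal property, and both
    directions of the theorem are proved from it and not from matrices.

    No gap implies hyperinvariant. Let X be characteristic. If N commutes with f
    and N^2 = 0, then 1 + N is an automorphism, so N X <= X
    ([characteristic_square_zero]). For i != l and g commuting with f, the map
    pi_l g pi_i squares to zero, and pi_i g pi_i acts on the chain of u_i as a
    polynomial in f. Hence X is hyperinvariant as soon as every pi_i preserves
    it ([hyperinvariant_of_proj]). If another block has the same size as block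
    i, then pi_i is the product of the square-zero maps u_i |-> u_l and
    u_l |-> u_i. If the sizes of multiplicity one never differ by more than one, at most two
    blocks remain. One remaining projection is the identity minus the others.
    Two remaining blocks have sizes r and r + 1, and there the square-zero maps
    u_i |-> f u_l and u_l |-> u_i suffice: of the two components of a vector of
    X, the one of greater or equal depth is generated by the image of the other
    ([proj_stable_consecutive]).

    A gap gives an example. Let u and v generate the only blocks of sizes r and
    s, with s > r + 1. The vectors of ker f^r without u-coefficient form the
    submodule R_r = ker f^(r-1) + f (ker f^(r+1)), preserved by the commutant.
    An automorphism multiplies u by a nonzero scalar modulo R_r, and the only
    nonzero scalar of GF(2) is 1; likewise for v and R_s. Therefore
    R_r + f R_s + <u + f v> is characteristic. It does not contain u, the
    projection of u + f v, because the gap keeps u and f v independent modulo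
    R_r + f R_s ([not_hyperinvariant_exists]).

    The two arguments are joined by the existence of the Jordan form of a
    nilpotent map, obtained by splitting off a longest chain
    ([jordan_form_exists]). *)

(** * Iterates of an endomorphism *)

Section Iterates.

Variables (K : fieldType) (V : vectType K).
Implicit Types (f g h : 'End(V)) (X : {vspace V}) (x y : V) (c : nat -> K).

Definition pow_end f n : 'End(V) := iter n (comp_lfun f) \1%VF.

Lemma pow_endE f n x : pow_end f n x = iter n f x.
Proof. by elim: n => [|n IH]; rewrite /= ?id_lfunE // comp_lfunE IH. Qed.

Lemma iter_addv f n x y : iter n f (x + y) = iter n f x + iter n f y.
Proof. by rewrite -!pow_endE linearD. Qed.

Lemma iter_subv f n x y : iter n f (x - y) = iter n f x - iter n f y.
Proof. by rewrite -!pow_endE linearB. Qed.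

Lemma iter_scale f n a x : iter n f (a *: x) = a *: iter n f x.
Proof. by rewrite -!pow_endE linearZ. Qed.

Lemma iter_zerov f n : iter n f (0 : V) = 0.
Proof. by rewrite -!pow_endE linear0. Qed.

Lemma iter_sumv f n (I : finType) (P : pred I) (F : I -> V) :
  iter n f (\sum_(i | P i) F i) = \sum_(i | P i) iter n f (F i).
Proof. by rewrite -pow_endE linear_sum /=; apply: eq_bigr => i _; rewrite -pow_endE. Qed.

Lemma iter_eq0_le f m n x : iter m f x = 0 -> (m <= n)%N -> iter n f x = 0.
Proof. by move=> fx0 /subnK<-; rewrite iterD fx0 iter_zerov. Qed.

Lemma mem_iter f X n x : invariant_vs f X -> x \in X -> iter n f x \in X.
Proof.
move=> /subvP invX Xx; elim: n => //= n IH.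
exact/invX/memv_img.
Qed.

Lemma commute_endP g f : commute_end g f <-> forall x, g (f x) = f (g x).
Proof.
split=> [gf x|gf]; first by move/lfunP/(_ x): gf; rewrite !comp_lfunE.
by apply/lfunP => x; rewrite !comp_lfunE.
Qed.

Lemma commute_iter g f n x : commute_end g f -> g (iter n f x) = iter n f (g x).
Proof. by move/commute_endP=> gf; elim: n => //= n IH; rewrite gf IH. Qed.

Lemma commute_comp g h f :
  commute_end g f -> commute_end h f -> commute_end (g \o h)%VF f.
Proof.
move=> /commute_endP gf /commute_endP hf; apply/commute_endP => x.
by rewrite !comp_lfunE hf gf.
Qed.

Lemma invariantP g X : invariant_vs g X <-> {in X, forall x, g x \in X}.
Proof.
split=> [/subvP inv x Xx|inv]; first exact/inv/memv_img.
by apply/subvP => _ /memv_imgP[x Xx ->]; apply: inv.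
Qed.

(** The action on x of the polynomial with coefficients c_0, ..., c_(n-1), the
    variable acting as f. *)
Definition orbit_comb f n c x := \sum_(j < n) c j *: iter j f x.

Lemma commute_comb g f n c x :
  commute_end g f -> g (orbit_comb f n c x) = orbit_comb f n c (g x).
Proof.
move=> gf; rewrite linear_sum /=; apply: eq_bigr => j _.
by rewrite linearZ /= (commute_iter _ _ gf).
Qed.

Lemma comb0 f n c : orbit_comb f n c 0 = 0.
Proof. by rewrite /orbit_comb big1 // => j _; rewrite iter_zerov scaler0. Qed.

Lemma iter_comb f m n c x :
  iter m f (orbit_comb f n c x) = orbit_comb f n c (iter m f x).
Proof.
rewrite iter_sumv; apply: eq_bigr => j _.
by rewrite iter_scale -!iterD addnC.
Qed.

Lemma combC f m n c d x :
  orbit_comb f m c (orbit_comb f n d x) = orbit_comb f n d (orbit_comb f m c x).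
Proof.
rewrite /orbit_comb; under eq_bigr => i _ do rewrite iter_sumv scaler_sumr.
under [RHS]eq_bigr => i _ do rewrite iter_sumv scaler_sumr.
rewrite exchange_big; apply: eq_bigr => i _; apply: eq_bigr => j _.
by rewrite !iter_scale !scalerA mulrC -!iterD addnC.
Qed.

Lemma comb_recl f n c x :
  orbit_comb f n.+1 c x = c 0 *: x + orbit_comb f n (c \o succn) (f x).
Proof.
by rewrite /orbit_comb big_ord_recl; congr (_ + _); apply: eq_bigr => j _ /=; rewrite -iterSr.
Qed.

Lemma mem_comb f X n c x : invariant_vs f X -> x \in X -> orbit_comb f n c x \in X.
Proof. by move=> invX Xx; apply: memv_suml => j _; apply: memvZ; apply: mem_iter. Qed.

(** In K[x]/(x^n) every element is x^m times a unit. So the f-invariant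
    subspaces that contain the combination are those that contain f^m x, with an
    m that depends only on the coefficients: the same m serves for several
    vectors x. *)
Lemma comb_leading f n c : exists m, forall X x,
  invariant_vs f X -> iter n f x = 0 ->
  (orbit_comb f n c x \in X) = (iter m f x \in X).
Proof.
elim: n c => [|n IH] c.
  by exists 0 => X x _ /= ->; rewrite comb0.
have [c0|c0] := eqVneq (c 0) 0.
  have [m Hm] := IH (c \o succn); exists m.+1 => X x invX.
  by rewrite comb_recl c0 scale0r add0r !iterSr => fx0; apply: Hm.
exists 0 => X x invX fx0; apply/idP/idP => [Xw|]; last exact: mem_comb.
(* Descending induction on the power of f: f^t applied to the combination is
   c_0 f^t x plus a combination of higher powers. *)
suff: forall d t, (n.+1 <= t + d)%N -> iter t f x \in X by move/(_ n.+1 0); apply.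
elim=> [|d IHd] t le_n; first by rewrite (iter_eq0_le fx0) ?mem0v // -(addn0 t).
have Xtw := mem_iter t invX Xw; move: Xtw.
rewrite iter_comb comb_recl => Xtw.
have Xtail : orbit_comb f n (c \o succn) (f (iter t f x)) \in X.
  by apply: mem_comb => //; apply: (IHd t.+1); rewrite addSnnS.
have : c 0 *: iter t f x \in X by rewrite -(rpredDr _ Xtail).
by move/(memvZ (c 0)^-1); rewrite scalerA mulVf // scale1r.
Qed.
End Iterates.

(** * Characteristic subspaces and square-zero maps *)

(** 1 + N is an automorphism with inverse 1 - N, and N x = (1 + N) x - x. *)
Lemma characteristic_square_zero (K : fieldType) (V : vectType K)
    (f N : 'End(V)) (X : {vspace V}) :
    characteristic_vs f X -> commute_end N f -> (forall x, N (N x) = 0) ->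
  {in X, forall x, N x \in X}.
Proof.
move=> [_ charX] /commute_endP Nf NN0 x Xx.
pose alpha := (\1 + N)%VF.
have alphaE y : alpha y = y + N y by rewrite add_lfunE id_lfunE.
have alpha_bij : bijective alpha.
  exists (fun y => y - N y) => y; rewrite alphaE.
    by rewrite linearD /= NN0 addr0 addrK.
  by rewrite linearB /= NN0 subr0 subrK.
have alpha_f : commute_end alpha f.
  by apply/commute_endP => y; rewrite !alphaE linearD Nf.
have : alpha x \in X by rewrite -(charX _ alpha_bij alpha_f) memv_img.
by rewrite alphaE rpredDl.
Qed.

Lemma commute_refl (K : fieldType) (V : vectType K) (f : 'End(V)) : commute_end f f.
Proof. by []. Qed.

(** * Generators of a Jordan decomposition *)

(** A generating family of the K[x]-module V that makes it a direct sum of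
    cyclic modules K[x]/(x^(p i)). Directness is expressed by the extension
    property: maps commuting with f may be prescribed freely on the
    generators. *)
Record jordan_generators (K : fieldType) (V : vectType K) (f : 'End(V))
    (k : nat) (p : 'I_k -> nat) (u : 'I_k -> V) : Prop := JordanGenerators {
  gen_order : forall i, iter (p i) f (u i) = 0;
  gen_minimal : forall i, iter (p i).-1 f (u i) != 0;
  gen_span : forall x, exists c : 'I_k -> nat -> K,
    x = \sum_i orbit_comb f (p i) (c i) (u i);
  gen_ext : forall w : 'I_k -> V, (forall i, iter (p i) f (w i) = 0) ->
    exists2 g : 'End(V), commute_end g f & forall i, g (u i) = w i
}.

Section Generators.

Variables (K : fieldType) (V : vectType K) (f : 'End(V)).
Variables (k : nat) (p : 'I_k -> nat) (u : 'I_k -> V).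
Hypothesis gens : jordan_generators f p u.

Lemma gen_eq (g h : 'End(V)) :
  commute_end g f -> commute_end h f -> (forall i, g (u i) = h (u i)) ->
  forall x, g x = h x.
Proof.
move=> gf hf gh x; have [c ->] := gen_span gens x.
rewrite !linear_sum; apply: eq_bigr => i _ /=.
by rewrite (commute_comb _ _ _ gf) (commute_comb _ _ _ hf) gh.
Qed.

(** These are the elementary matrices of the commutant: the projections and the
    square-zero maps between two chains are the cases used below. *)
Lemma gen_elementary i w : iter (p i) f w = 0 ->
  exists2 g : 'End(V), commute_end g f &
    forall l, g (u l) = if l == i then w else 0.
Proof.
move=> fw0; have [l|g gf gu] := gen_ext gens (w := fun l => if l == i then w else 0).
  by case: eqP => [->|_] //; rewrite iter_zerov.
by exists g.
Qed.

Lemma gen_projections : exists2 pi : 'I_k -> 'End(V),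
  forall i, commute_end (pi i) f &
  forall i l, pi i (u l) = if l == i then u i else 0.
Proof.
exact: fin_all_exists2 (fun i => gen_elementary (gen_order gens i)).
Qed.

Variable pi : 'I_k -> 'End(V).
Hypothesis pi_f : forall i, commute_end (pi i) f.
Hypothesis pi_u : forall i l, pi i (u l) = if l == i then u i else 0.

Lemma commute_id : commute_end (\1%VF : 'End(V)) f.
Proof. by apply/commute_endP => x; rewrite !id_lfunE. Qed.

Lemma commute_0 : commute_end (0 : 'End(V)) f.
Proof. by apply/commute_endP => x; rewrite !zero_lfunE linear0. Qed.

Lemma proj_orth i l x : i != l -> pi l (pi i x) = 0.
Proof.
move=> ne_il; rewrite -comp_lfunE -(zero_lfunE V x).
apply: gen_eq => [||m]; [exact: commute_comp | exact: commute_0 |].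
rewrite comp_lfunE zero_lfunE pi_u; case: eqP => [_|]; rewrite ?linear0 //.
by rewrite pi_u (negPf ne_il).
Qed.

Lemma proj_sum x : \sum_i pi i x = x.
Proof.
rewrite -sum_lfunE -[RHS]id_lfunE; apply: gen_eq => [||l].
- apply/commute_endP => y; rewrite !sum_lfunE linear_sum /=.
  by apply: eq_bigr => i _; move/commute_endP: (pi_f i).
- exact: commute_id.
rewrite sum_lfunE id_lfunE (bigD1 l) //= pi_u eqxx big1 ?addr0 // => i ne_il.
by rewrite pi_u eq_sym (negPf ne_il).
Qed.

Lemma proj_comb i x : exists c, pi i x = orbit_comb f (p i) c (u i).
Proof.
have [c ->] := gen_span gens x; exists (c i).
rewrite linear_sum (bigD1 i) //= (commute_comb _ _ _ (pi_f i)) pi_u eqxx.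
rewrite big1 ?addr0 // => l ne_li.
by rewrite (commute_comb _ _ _ (pi_f i)) pi_u (negPf ne_li) comb0.
Qed.

Section Characteristic.

Variable X : {vspace V}.
Hypothesis charX : characteristic_vs f X.

Definition proj_stable i := {in X, forall x, pi i x \in X}.

(** Decompose g as the sum of the pi_l g pi_i. Off the diagonal these square to
    zero; on the diagonal, pi_i g sends u_i to q(f) u_i for some polynomial q,
    hence acts as q(f) on the whole chain. *)
Lemma hyperinvariant_of_proj :
  (forall i, proj_stable i) -> hyperinvariant_vs f X.
Proof.
move=> piX g gf; apply/invariantP => x Xx.
rewrite -(proj_sum x) linear_sum /=; apply: memv_suml => i _.
rewrite -(proj_sum (g _)); apply: memv_suml => l _.
have [<-|ne_il] := eqVneq i l.
  have [c pix] := proj_comb i x; have [d giu] := proj_comb i (g (u i)).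
  rewrite pix (commute_comb _ _ _ gf) (commute_comb _ _ _ (pi_f i)) giu.
  by rewrite combC -pix; apply: mem_comb; [case: charX | apply: piX].
rewrite -!comp_lfunE; apply: (characteristic_square_zero charX) => //.
  by do 2 apply: commute_comp => //.
by move=> y; rewrite !comp_lfunE proj_orth ?linear0 // eq_sym.
Qed.

(** A map that sends u_i into another chain and kills the other generators
    squares to zero. *)
Lemma elementary_stable i l n (g : 'End(V)) : i != l -> commute_end g f ->
    (forall m, g (u m) = if m == i then iter n f (u l) else 0) ->
  {in X, forall x, g x \in X}.
Proof.
move=> ne gf gu; apply: (characteristic_square_zero charX) => // y.
rewrite -comp_lfunE -(zero_lfunE V y).
apply: gen_eq => [||m]; [exact: commute_comp | exact: commute_0 |].
rewrite comp_lfunE zero_lfunE gu; case: eqP => _; last by rewrite linear0.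
by rewrite (commute_iter _ _ gf) gu eq_sym (negPf ne) iter_zerov.
Qed.

(** Two chains of equal length are isomorphic: pi_i factors through the other
    chain as a product of two square-zero maps. *)
Lemma proj_stable_repeated i l : i != l -> p i = p l -> proj_stable i.
Proof.
move=> ne_il eq_p.
have [|E Ef Eu] := gen_elementary (i := i) (w := u l).
  by rewrite eq_p (gen_order gens).
have [|E' E'f E'u] := gen_elementary (i := l) (w := u i).
  by rewrite -eq_p (gen_order gens).
move=> x Xx; have -> : pi i x = E' (E x).
  rewrite -comp_lfunE; apply: gen_eq => [||m] //; first exact: commute_comp.
  by rewrite comp_lfunE pi_u Eu; case: eqP => _; rewrite ?linear0 // E'u eqxx.
have ne_li : l != i by rewrite eq_sym.
apply: (elementary_stable (n := 0) ne_li E'f E'u).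
exact: (elementary_stable (n := 0) ne_il Ef Eu).
Qed.

Lemma proj_stable_last i :
  (forall l, l != i -> proj_stable l) -> proj_stable i.
Proof.
move=> piX x Xx; have := proj_sum x; rewrite (bigD1 i) //= => /(canRL (addrK _))->.
by apply: rpredB => //; apply: memv_suml => l /piX; apply.
Qed.

(** Let a + b in X have components a = p(f) u_i and b = q(f) u_l, with p and q of
    lowest degrees mc and md. The map u_i |-> f u_l puts f^(mc+1) u_l into X,
    and u_l |-> u_i puts f^md u_i into X. If md <= mc, the latter generates a;
    otherwise the former generates b. *)
Lemma proj_stable_consecutive i l : p l = (p i).+1 ->
  (forall m, m != i -> m != l -> proj_stable m) -> proj_stable i /\ proj_stable l.
Proof.
move=> pl piX; have ne_il : i != l by apply/eqP => eil; move: pl; rewrite eil => /n_Sn.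
have [invX _] := charX.
suff Xi : proj_stable i.
  split=> //; apply: proj_stable_last => m ne_ml.
  by have [->|ne_mi] := eqVneq m i => //; apply: piX.
move=> x Xx.
have Xab : pi i x + pi l x \in X.
  have := proj_sum x; rewrite (bigD1 i) //= (bigD1 l) 1?eq_sym //= addrA.
  move=> /(canRL (addrK _))->; apply: rpredB => //; apply: memv_suml => m.
  by case/andP=> ? ?; apply: piX.
have [|N Nf Nu] := gen_elementary (i := i) (w := f (u l)).
  by rewrite -iterSr -pl (gen_order gens).
have [|N' N'f N'u] := gen_elementary (i := l) (w := u i).
  by rewrite pl iterS (gen_order gens) linear0.
have ui0 : iter (p l) f (u i) = 0 by rewrite pl iterS (gen_order gens) linear0.
have ul0 : iter (p l) f (f (u l)) = 0 by rewrite -iterSr iterS (gen_order gens) linear0.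
have [c pix] : exists c, pi i x = orbit_comb f (p l) c (u i).
  (* The additional term vanishes since f^(p i) kills u_i; both components can
     then be treated with the length p l. *)
  have [c ->] := proj_comb i x; exists c.
  by rewrite pl [RHS]/orbit_comb big_ord_recr /= (gen_order gens) scaler0 addr0.
have [d plx] := proj_comb l x.
have [mc Hc] := comb_leading f (p l) c; have [md Hd] := comb_leading f (p l) d.
have Xc : iter mc.+1 f (u l) \in X.
  rewrite iterSr -Hc //; have /= := elementary_stable (n := 1) ne_il Nf Nu Xab.
  rewrite linearD /= pix plx (commute_comb _ _ _ Nf) (commute_comb _ _ _ Nf) !Nu eqxx.
  by rewrite eq_sym (negPf ne_il) comb0 addr0.
have Xd : iter md f (u i) \in X.
  rewrite -Hd //; have ne_li : l != i by rewrite eq_sym.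
  have /= := elementary_stable (n := 0) ne_li N'f N'u Xab.
  rewrite linearD /= pix plx (commute_comb _ _ _ N'f) (commute_comb _ _ _ N'f) !N'u eqxx.
  by rewrite (negPf ne_il) comb0 add0r.
have [le_dc|lt_cd] := leqP md mc.
  by rewrite pix Hc // -(subnK le_dc) iterD mem_iter.
suff Xb : pi l x \in X by rewrite -(rpredDr _ Xb).
by rewrite plx Hd ?(gen_order gens) // -(subnK lt_cd) iterD mem_iter.
Qed.

End Characteristic.
End Generators.

(** * Block sizes of multiplicity one *)

Section Multiplicity.

Variables (K : fieldType) (V : vectType K) (f : 'End(V)).
Variables (k : nat) (p : 'I_k -> nat) (u : 'I_k -> V).

Definition sole_size (n : nat) := #|[set i | p i == n]| == 1%N.

Lemma sole_size_inj i l : sole_size (p i) -> p l = p i -> l = i.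
Proof.
move=> /cards1P[m Em] eq_p.
have /set1P -> : l \in [set m] by rewrite -Em inE eq_p.
by apply/esym/set1P; rewrite -Em inE.
Qed.

Lemma not_sole_size i : ~~ sole_size (p i) -> exists2 l, i != l & p i = p l.
Proof.
move=> not1; have [l /andP[/eqP]|none] := pickP [pred l | (p l == p i) && (l != i)].
  by exists l => //; rewrite eq_sym.
case/negP: not1; apply/cards1P; exists i; apply/setP => l; rewrite !inE.
have := none l; rewrite /=; case: (eqVneq l i) => [->|_]; first by rewrite eqxx.
by rewrite andbT.
Qed.

Lemma sole_size_witness n : #|[set i | p i == n]| = 1%N ->
  exists2 i, p i = n & sole_size (p i).
Proof.
move=> n1; have /eqP/cards1P[i Ei] := n1.
have pi : p i = n.
  by apply/eqP; have := set11 i; rewrite -Ei inE.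
by exists i => //; rewrite pi; apply/eqP.
Qed.

(** Three distinct sizes cannot be pairwise within distance one, so at most two
    blocks have a size of multiplicity one; the projections onto all other
    chains preserve X. *)
Lemma characteristic_hyperinvariant X :
    jordan_generators f p u ->
    (forall i l, sole_size (p i) -> sole_size (p l) -> (p l <= (p i).+1)%N) ->
  characteristic_vs f X -> hyperinvariant_vs f X.
Proof.
move=> gens close charX; have [pi pi_f pi_u] := gen_projections gens.
apply: (hyperinvariant_of_proj gens pi_f pi_u charX) => i.
have rep m : ~~ sole_size (p m) -> proj_stable pi X m.
  by case/not_sole_size => l; apply: (proj_stable_repeated gens pi_f pi_u charX).
have [sole_i|] := boolP (sole_size (p i)); last exact: rep.
have [l /andP[ne_li sole_l]|none] := pickP [pred l | (l != i) && sole_size (p l)].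
  have distinct m n : sole_size (p m) -> m != n -> p m != p n.
    by move=> sm; apply: contraNneq => eq_p; rewrite (sole_size_inj sm (esym eq_p)).
  have others m : m != i -> m != l -> proj_stable pi X m.
    move=> ne_mi ne_ml; apply: rep; apply/negP => sole_m.
    have := distinct i l sole_i; rewrite eq_sym ne_li => /(_ isT).
    have := distinct m i sole_m ne_mi; have := distinct m l sole_m ne_ml.
    move: (close i l sole_i sole_l) (close l i sole_l sole_i).
    move: (close i m sole_i sole_m) (close m i sole_m sole_i).
    move: (close m l sole_m sole_l) (close l m sole_l sole_m).
    move: (p i) (p l) (p m) => a b c; lia.
  have [eq_p|eq_p] : p l = (p i).+1 \/ p i = (p l).+1.
    have := distinct i l sole_i; rewrite eq_sym ne_li => /(_ isT).
    move: (close i l sole_i sole_l) (close l i sole_l sole_i); lia.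
  - by case: (proj_stable_consecutive gens pi_f pi_u charX eq_p others).
  - have others' m : m != l -> m != i -> proj_stable pi X m by move=> ? ?; apply: others.
    by case: (proj_stable_consecutive gens pi_f pi_u charX eq_p others').
apply: (proj_stable_last gens pi_f pi_u) => l ne_li; apply: rep.
by have := none l; rewrite /= ne_li => /negbT.
Qed.

End Multiplicity.

(** * A characteristic subspace that is not hyperinvariant *)

Section BlockRadical.

Variables (K : fieldType) (V : vectType K) (f : 'End(V)).
Implicit Types (g : 'End(V)) (x y : V) (n : nat).

(** ker f^n modulo this subspace has the number of blocks of size n as its
    dimension: it consists of the vectors of ker f^n that have no component
    along the generators of the chains of length n. The formula does not refer
    to a basis, so the commutant visibly preserves it. *)
Definition block_radical n :=
  (lker (pow_end f n.-1) + f @: lker (pow_end f n.+1))%VS.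

Lemma block_radicalP n y :
  reflect (exists a b, [/\ iter n.-1 f a = 0, iter n.+1 f b = 0 & y = a + f b])
          (y \in block_radical n).
Proof.
apply: (iffP memv_addP) => [[a + [_ /memv_imgP[b + ->] ->]]|[a [b [fa fb ->]]]].
  by rewrite !memv_ker !pow_endE => /eqP fa /eqP fb; exists a, b.
exists a; first by rewrite memv_ker pow_endE fa.
by exists (f b) => //; apply: memv_img; rewrite memv_ker pow_endE fb.
Qed.

Lemma block_radical_invariant g n : commute_end g f ->
  {in block_radical n, forall y, g y \in block_radical n}.
Proof.
move=> gf _ /block_radicalP[a [b [fa fb ->]]]; apply/block_radicalP.
exists (g a), (g b); rewrite -!(commute_iter _ _ gf) fa fb linear0 linearD.
by split=> //=; move/commute_endP: gf => ->.
Qed.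

Lemma block_radical_ker n y : iter n.-1 f y = 0 -> y \in block_radical n.
Proof.
move=> fy; apply/block_radicalP; exists y, 0.
by rewrite iter_zerov linear0 addr0.
Qed.

Variables (k : nat) (p : 'I_k -> nat) (u : 'I_k -> V).
Hypothesis gens : jordan_generators f p u.
Variable pi : 'I_k -> 'End(V).
Hypothesis pi_f : forall i, commute_end (pi i) f.
Hypothesis pi_u : forall i l, pi i (u l) = if l == i then u i else 0.

Lemma gen_gt0 i : (0 < p i)%N.
Proof.
have := gen_order gens i; have := gen_minimal gens i.
by case: (p i) => //= /negP ui0 /eqP.
Qed.

Lemma iter_proj i x : iter (p i) f (pi i x) = 0.
Proof.
have [c ->] := proj_comb gens pi_f pi_u i x.
by rewrite iter_comb (gen_order gens) comb0.
Qed.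

(** On the chain of u_i the map f^(p i - 1) retains only the coefficient of u_i,
    which vanishes on the radical. *)
Lemma proj_block_radical i y :
  y \in block_radical (p i) -> iter (p i).-1 f (pi i y) = 0.
Proof.
case/block_radicalP=> a [b [fa _ ->]].
rewrite linearD iter_addv -!(commute_iter _ _ (pi_f i)) fa linear0 add0r.
by rewrite -iterSr (prednK (gen_gt0 i)) (commute_iter _ _ (pi_f i)) iter_proj.
Qed.

Lemma gen_block_radical i c :
  c *: u i \in block_radical (p i) -> c = 0.
Proof.
move/proj_block_radical/eqP.
rewrite linearZ /= pi_u eqxx iter_scale scaler_eq0 (negPf (gen_minimal gens i)) orbF.
by move/eqP.
Qed.

Lemma proj_head i x : exists c y, pi i x = c *: u i + f y /\ iter (p i) f y = 0.
Proof.
have [d ->] := proj_comb gens pi_f pi_u i x; have := gen_order gens i.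
case: (p i) (gen_gt0 i) => // n _ fu0.
exists (d 0), (orbit_comb f n (d \o succn) (u i)); split.
  by rewrite comb_recl (commute_comb _ _ _ (commute_refl f)).
by rewrite iter_comb fu0 comb0.
Qed.

(** A component of x in a shorter chain is killed by f^(p i - 1); in a longer
    chain, it has no coefficient at the generator and lies in
    f (ker f^(p i + 1)). Only the chain of u_i contributes a generator. *)
Lemma ker_mod_block_radical i x : sole_size p (p i) -> iter (p i) f x = 0 ->
  exists c, x - c *: u i \in block_radical (p i).
Proof.
move=> sole_i fx; have fpx l : iter (p i) f (pi l x) = 0.
  by rewrite -(commute_iter _ _ (pi_f l)) fx linear0.
have [c [y [pix fy]]] := proj_head i x; exists c.
rewrite -{1}(proj_sum gens pi_f pi_u x) (bigD1 i) //= pix addrAC (addrC (c *: _)) addrK.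
apply: rpredD.
  apply/block_radicalP; exists 0, y; rewrite iter_zerov add0r; split=> //.
  by rewrite iterS fy linear0.
apply: memv_suml => l ne_li.
have [lt_p|lt_p|eq_p] := ltngtP (p l) (p i).
- apply: block_radical_ker; apply: iter_eq0_le (iter_proj l x) _.
  by rewrite -ltnS (prednK (gen_gt0 i)).
- have := fpx l; have [c' [z [-> fz]]] := proj_head l x => fpl.
  have c'0 : c' = 0.
    have le_p : (p i <= (p l).-1)%N by rewrite -ltnS (prednK (gen_gt0 l)).
    have /eqP := iter_eq0_le fpl le_p.
    rewrite iter_addv -iterSr (prednK (gen_gt0 l)) fz addr0 iter_scale scaler_eq0.
    by rewrite (negPf (gen_minimal gens l)) orbF => /eqP.
  move: fpl; rewrite c'0 scale0r add0r -iterSr => fz'.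
  by apply/block_radicalP; exists 0, z; rewrite iter_zerov add0r.
- by case/eqP: ne_li; apply: sole_size_inj sole_i eq_p.
Qed.

End BlockRadical.

(** With R_i and R_l the radicals for the two sizes, the witness is
    X = R_i + f R_l + <u_i + f u_l>. *)
Lemma not_hyperinvariant_exists (V : vectType 'F_2) (f : 'End(V))
    (k : nat) (p : 'I_k -> nat) (u : 'I_k -> V) i l :
    jordan_generators f p u -> sole_size p (p i) -> sole_size p (p l) ->
    (p i + 1 < p l)%N ->
  exists X, characteristic_vs f X /\ ~ hyperinvariant_vs f X.
Proof.
move=> gens sole_i sole_l lt_p; have [pi pi_f pi_u] := gen_projections gens.
have ne_li : l != i by apply: contraTneq lt_p => ->; rewrite -leqNgt leq_addr.
(* Automorphisms fix the two generators modulo their radicals: the coefficient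
   cannot be 0, since the inverse automorphism would put the generator in the
   radical, and GF(2) has no other nonzero element than 1. *)
have fix_gen j (alpha : 'End(V)) : sole_size p (p j) -> bijective alpha -> commute_end alpha f ->
    alpha (u j) - u j \in block_radical f (p j).
  move=> sole_j [beta alphaK betaK] alpha_f.
  have alpha0 : lker alpha == 0%VS by apply/lker0P; apply: can_inj alphaK.
  have fau : iter (p j) f (alpha (u j)) = 0.
    by rewrite -(commute_iter _ _ alpha_f) (gen_order gens) linear0.
  have [c] := ker_mod_block_radical gens pi_f pi_u sole_j fau.
  have [->|c0] := eqVneq c 0; last first.
    by have -> : c = 1; [apply/eqP; move: c0; case: c => [[|[|[]]]] | rewrite scale1r].
  rewrite scale0r subr0 => au_rad.
  have inv_f : commute_end alpha^-1%VF f.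
    apply/commute_endP => x; rewrite -{1}(lker0_lfunVK alpha0 x).
    by move/commute_endP: alpha_f => <-; rewrite lker0_lfunK.
  have := block_radical_invariant inv_f au_rad; rewrite lker0_lfunK // -[u j]scale1r.
  by move/(gen_block_radical gens pi_f pi_u)/eqP; rewrite oner_eq0.
pose z := u i + f (u l).
pose H := (block_radical f (p i) + f @: block_radical f (p l))%VS.
pose X := (H + <[z]>)%VS.
have H_inv (g : 'End(V)) : commute_end g f -> {in H, forall y, g y \in H}.
  move=> gf _ /memv_addP[a Ra [_ /memv_imgP[b Rb ->] ->]].
  rewrite linearD /=; move/commute_endP: (gf) => -> /=; apply: memv_add.
    exact: block_radical_invariant.
  by apply: memv_img; apply: block_radical_invariant.
have X_inv (g : 'End(V)) : g z - z \in H -> commute_end g f -> {in X, forall x, g x \in X}.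
  move=> gz gf _ /memv_addP[a Ha [_ /vlineP[c ->] ->]].
  rewrite linearD linearZ /= -(subrK z (g z)) scalerDr addrA memv_add ?memvZ ?memv_line //.
  by rewrite rpredD ?memvZ // H_inv.
have H_sub : {subset H <= X} by apply/subvP; apply: addvSl.
exists X; split; first split.
- apply/invariantP => _ /memv_addP[a Ha [_ /vlineP[c ->] ->]].
  rewrite linearD linearZ /= linearD /=; apply: H_sub.
  apply: rpredD; first exact: (H_inv _ (commute_refl f)).
  apply: memvZ; apply: memv_add.
    by apply: block_radical_ker; rewrite -iterSr prednK ?(gen_order gens) ?(gen_gt0 gens).
  apply: memv_img; apply: block_radical_ker.
  by rewrite -iterSr prednK ?(gen_order gens) ?(gen_gt0 gens).
- move=> alpha alpha_bij alpha_f.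
  have alpha0 : lker alpha == 0%VS by apply/lker0P; apply: bij_inj.
  apply/eqP; rewrite eqEdim limg_dim_eq ?(eqP alpha0) ?capv0 // leqnn andbT.
  apply/subvP => _ /memv_imgP[x Xx ->]; move: x Xx; apply: X_inv => //.
  rewrite /z linearD /= opprD addrACA; apply: memv_add; first exact: fix_gen.
  move/commute_endP: (alpha_f) => -> /=; rewrite -linearB; apply: memv_img.
  exact: fix_gen.
(* The coefficients of u_i and of f u_l vanish on R_i + f R_l; they are read off
   at the ends of their chains. The second one needs the gap: R_i is killed
   there because p i - 1 <= p l - 2 and p i + 1 <= p l - 1. *)
have kill_i h : h \in H -> iter (p i).-1 f (pi i h) = 0.
  case/memv_addP=> a Ra [_ /memv_imgP[b _ ->] ->]; rewrite linearD iter_addv /=.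
  rewrite (proj_block_radical gens pi_f pi_u Ra) add0r.
  move/commute_endP: (pi_f i) => ->; rewrite -iterSr (prednK (gen_gt0 gens i)).
  exact: (iter_proj gens pi_f pi_u i b).
have kill_l h : h \in H -> iter (p l).-2 f (pi l h) = 0.
  case/memv_addP=> _ /block_radicalP[a [b [fa fb ->]]] [_ /memv_imgP[c Rc ->] ->].
  rewrite !linearD !iter_addv /= -!(commute_iter _ _ (pi_f l)) -!iterSr.
  have -> : iter (p l).-2 f a = 0 by apply: iter_eq0_le fa _; lia.
  have -> : iter (p l).-2.+1 f b = 0 by apply: iter_eq0_le fb _; lia.
  rewrite linear0 !add0r (_ : (p l).-2.+1 = (p l).-1) 1?(commute_iter _ _ (pi_f l)); last lia.
  exact: (proj_block_radical gens pi_f pi_u Rc).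
move=> /(_ (pi i) (pi_f i))/invariantP/(_ z (subvP (addvSr _ _) _ (memv_line z))).
rewrite linearD /=; move/commute_endP: (pi_f i) => -> /=.
rewrite !pi_u eqxx (negPf ne_li) linear0 addr0 => /memv_addP[h Hh [_ /vlineP[c ->] eq_u]].
have hE : h = (1 - c) *: u i - c *: f (u l).
  by rewrite scalerBl scale1r -[LHS](addrK (c *: z)) -eq_u scalerDr opprD addrA.
have c1 : 1 - c = 0.
  have /eqP := kill_i _ Hh; rewrite hE linearB !linearZ /=.
  move/commute_endP: (pi_f i) => -> /=; rewrite !pi_u eqxx (negPf ne_li).
  rewrite linear0 oppr0 scaler0 addr0 iter_scale scaler_eq0 (negPf (gen_minimal gens i)) orbF.
  by move/eqP.
have /eqP := kill_l _ Hh; rewrite hE c1 scale0r sub0r.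
have -> : c = 1 by apply/esym/eqP; rewrite -subr_eq0 c1.
rewrite scale1r linearN /=; move/commute_endP: (pi_f l) => -> /=; rewrite pi_u eqxx.
rewrite -(sub0r (f _)) iter_subv iter_zerov sub0r -iterSr (_ : (p l).-2.+1 = (p l).-1); last lia.
by rewrite oppr_eq0 (negPf (gen_minimal gens l)).
Qed.

(** * From a Jordan form to generators *)

Section FromJordanForm.

Variables (K : fieldType) (V : vectType K) (f : 'End(V)).
Variables (k : nat) (p : 'I_k -> nat).

Lemma sum_over_blocks (F : 'I_(\sum_i p i) -> V) :
  \sum_s F s = \sum_i \sum_(j < p i) F (tagnat.Rank _ j).
Proof.
rewrite (reindex _ (tagnat.rank_bij_on (p_ := p))) sig_big_dep /=.
by apply: eq_bigr => -[].
Qed.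

Lemma mxdiag_sum_col (B : forall i, 'M[K]_(p i)) (E : 'I_(\sum_i p i) -> V)
    i (j : 'I_(p i)) :
  \sum_s (\mxdiag_i B i) s (tagnat.Rank _ j) *: E s =
  \sum_j' B i j' j *: E (tagnat.Rank _ j').
Proof.
rewrite sum_over_blocks.
rewrite (bigD1 i) //= [X in _ + X]big1 ?addr0 => [|i' ne_i].
  apply: eq_bigr => j' _.
  by have /matrixP/(_ j' j) := submxblock_diag B i; rewrite mxE => ->.
apply: big1 => j' _.
by rewrite mxE ifN ?mxE ?scale0r // !tagnat.Rank1K.
Qed.

(** Within a block, f multiplies a basis vector by the eigenvalue and adds its
    predecessor; the sum has at most one term, and none for the first vector of
    the block. *)
Lemma represents_jordanP (a : 'I_k -> K) (e : (\sum_i p i).-tuple V) :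
  represents (\mxdiag_(i < k) jordan_block (a i) (p i)) e f <->
  forall i (j : 'I_(p i)), f e`_(tagnat.Rank _ j) =
    a i *: e`_(tagnat.Rank _ j) +
    \sum_(j' < p i | j'.+1 == j) e`_(tagnat.Rank _ j').
Proof.
have col i (j : 'I_(p i)) :
    \sum_s (\mxdiag_(i < k) jordan_block (a i) (p i)) s (tagnat.Rank _ j) *: e`_s =
    a i *: e`_(tagnat.Rank _ j) + \sum_(j' < p i | j'.+1 == j) e`_(tagnat.Rank _ j').
  rewrite (mxdiag_sum_col _ (fun s => e`_s)).
  have split_entry (j' : 'I_(p i)) : jordan_block (a i) (p i) j' j *: e`_(tagnat.Rank _ j') =
      a i *+ (j' == j) *: e`_(tagnat.Rank _ j') + (j'.+1 == j)%:R *: e`_(tagnat.Rank _ j').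
    by rewrite !mxE scalerDl.
  rewrite (eq_bigr _ (fun j' _ => split_entry j')) big_split /=; congr (_ + _).
    rewrite (bigD1 j) ?eqxx ?mulr1n //= [X in _ + X]big1 ?addr0 // => j' /negPf ne_j.
    by rewrite ne_j mulr0n scale0r.
  rewrite [RHS]big_mkcond; apply: eq_bigr => j' _.
  by case: ifP; rewrite ?scale1r ?scale0r.
split=> [rep i j|rep s]; first by rewrite rep col.
by rewrite -(tagnat.sig2K s) col rep.
Qed.

Lemma nilpotent_eigenvalue (x : V) b :
  nilpotent_end f -> x != 0 -> f x = b *: x -> b = 0.
Proof.
move=> [n fn0] x0 fx; have iterE m : iter m f x = b ^+ m *: x.
  elim: m => [|m IH]; first by rewrite scale1r.
  by rewrite iterS IH linearZ /= fx scalerA -exprSr.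
have /eqP := fn0 x; rewrite iterE scaler_eq0 (negPf x0) orbF expf_eq0.
by case/andP=> _ /eqP.
Qed.

(** Nilpotency forces all eigenvalues to be zero, and then the last basis vector
    of a block generates its chain: f runs through the block backwards, which
    explains the reversal of ordinals. *)
Lemma jordan_form_generators (a : 'I_k -> K) : nilpotent_end f ->
  has_jordan_form f a p -> exists u : 'I_k -> V, jordan_generators f p u.
Proof.
move=> nilp [p_gt0 [e [e_basis /represents_jordanP rep_e]]].
pose b i (j : 'I_(p i)) := e`_(tagnat.Rank _ j).
have rep i (j : 'I_(p i)) :
    f (b i j) = a i *: b i j + \sum_(j' < p i | j'.+1 == j) b i j' := rep_e i j.
have e_nz i (j : 'I_(p i)) : b i j != 0.
  by apply: (basis_not0 e_basis); rewrite mem_nth // size_tuple.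
have a0 i : a i = 0.
  apply: (nilpotent_eigenvalue nilp (e_nz i (Ordinal (p_gt0 i)))).
  by rewrite rep big_pred0 ?addr0.
pose last_ord i : 'I_(p i) := rev_ord (Ordinal (p_gt0 i)).
pose u i := b i (last_ord i).
have iter_u m i (j : 'I_(p i)) : j = m :> nat -> iter m f (u i) = b i (rev_ord j).
  elim: m j => [|m IH] j jm.
    by rewrite /u /last_ord; congr (b i (rev_ord _)); apply: val_inj; rewrite /= jm.
  have lt_m : (m < p i)%N by rewrite ltnW // -jm.
  rewrite iterS (IH (Ordinal lt_m)) // rep a0 scale0r add0r.
  rewrite (big_pred1 (rev_ord j)) // => j' /=; rewrite -val_eqE /=.
  by have := ltn_ord j; have := ltn_ord j'; rewrite jm; lia.
have last_u i : iter (p i) f (u i) = 0.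
  have lt_m : ((p i).-1 < p i)%N by rewrite prednK.
  rewrite -{1}(prednK (p_gt0 i)) iterS (iter_u _ _ (Ordinal lt_m)) // rep a0 scale0r add0r.
  by apply: big_pred0 => j' /=; rewrite prednK // subnn.
have span x : exists c : 'I_k -> nat -> K, x = \sum_i orbit_comb f (p i) (c i) (u i).
  exists (fun i m => if insub m : option 'I_(p i) is Some j
    then coord e (tagnat.Rank i (rev_ord j)) x else 0).
  rewrite {1}(coord_basis e_basis (memvf x)).
  rewrite sum_over_blocks.
  apply: eq_bigr => i _; rewrite (reindex_inj rev_ord_inj) /=.
  apply: eq_bigr => j _; rewrite (iter_u _ _ j) // insubT //= => lt_j.
  by congr (coord e (tagnat.Rank _ (rev_ord _)) x *: _); apply: val_inj.
exists u; split => // [i|w fw0].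
  have lt_m : ((p i).-1 < p i)%N by rewrite prednK.
  by rewrite (iter_u _ _ (Ordinal lt_m)).
pose G (t : {i & 'I_(p i)}) := iter (rev_ord (tagged t)) f (w (tag t)).
have [g] := linear_of_free e [seq G (tagnat.sig s) | s <- enum 'I_(\sum_i p i)].
move=> /(_ (basis_free e_basis)); rewrite size_map size_enum_ord size_tuple => /(_ erefl) gE.
have g_iter i m : linfun g (iter m f (u i)) = iter m f (w i).
  have [lt_m|le_m] := ltnP m (p i); last first.
    by rewrite (iter_eq0_le (last_u i)) // (iter_eq0_le (fw0 i)) // linear0.
  rewrite (iter_u _ _ (Ordinal lt_m)) // lfunE /= /b.
  set s := tagnat.Rank _ _; have := congr1 (fun l => l`_s) gE.
  rewrite (nth_map 0) ?size_tuple // (nth_map s) ?size_enum_ord // nth_ord_enum => ->.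
  rewrite /s /tagnat.Rank tagnat.rankK /G /=; congr (iter _ f _); lia.
exists (linfun g); last by move=> i; apply: (g_iter i 0).
apply/commute_endP => x; have [c ->] := span x.
rewrite !linear_sum /=; apply: eq_bigr => i _; rewrite /orbit_comb !linear_sum /=.
by apply: eq_bigr => j _; rewrite !linearZ /= -iterS !g_iter.
Qed.

End FromJordanForm.

(** * Existence of the Jordan form *)

Section SplitChain.

Variables (K : fieldType) (V : vectType K) (f : 'End(V)).

Lemma functional_nonzero (z : V) : z != 0 -> exists phi : 'Hom(V, K^o), phi z != 0.
Proof.
move=> z0; pose b := vbasis (@fullv K V).
have [i zi|all0] := pickP (fun i => coord b i z != 0).
  by exists (linfun (coord b i : V -> K^o)); rewrite lfunE.
case/eqP: z0; rewrite (coord_vbasis (memvf z)) big1 // => i _.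
by have /negbFE/eqP -> := all0 i; rewrite scale0r.
Qed.

Variable phi : 'Hom(V, K^o).

Definition orbit_values n (x : V) : 'rV[K]_n := \row_j (phi (iter j f x) : K).

Fact orbit_values_linear n : linear (orbit_values n).
Proof.
move=> c x y; apply/rowP => j.
by rewrite !mxE iter_addv iter_scale linearD linearZ.
Qed.

HB.instance Definition _ n :=
  GRing.isLinear.Build K V 'rV[K]_n _ (orbit_values n) (@orbit_values_linear n).

(** The matrix of the values phi (f^(j+m) u) is anti-triangular with nonzero
    antidiagonal, as f^n u = 0. The system is solved from the last equation
    down, adding a multiple of f^m u to correct the equation n - m - 1. *)
Lemma orbit_interpolation n u (r : nat -> K) :
    phi (iter n.-1 f u) != 0 -> iter n f u = 0 ->
  exists2 y, y \in <<traject f u n>>%VS &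
             forall j, (j < n)%N -> phi (iter j f y) = r j.
Proof.
move=> phi_u fu0.
suff /(_ n (leqnn n))[y uy yr] : forall m, (m <= n)%N -> exists2 y, y \in <<traject f u n>>%VS &
    forall j, (n - m <= j < n)%N -> phi (iter j f y) = r j.
  by exists y => // j lt_j; apply: yr; rewrite subnn.
elim=> [|m IH] lt_m; first by exists 0; [exact: mem0v | move=> j; lia].
have [y uy yr] := IH (ltnW lt_m).
pose c := (r (n - m.+1)%N - phi (iter (n - m.+1) f y)) / phi (iter n.-1 f u).
exists (y + c *: iter m f u).
  rewrite memvD // memvZ // memv_span //; apply/trajectP; by exists m.
move=> j /andP[le_j lt_j]; rewrite iter_addv iter_scale linearD linearZ /= -iterD.
have [->|ne_j] := eqVneq j (n - m.+1)%N; last first.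
  rewrite yr; last lia.
  by rewrite (iter_eq0_le fu0) ?linear0 ?scaler0 ?addr0 //; lia.
have -> : (n - m.+1 + m = n.-1)%N by lia.
by rewrite -[_ *: _]/(_ * _) /c divfK // addrC subrK.
Qed.

(** The complement of the chain of u in U is the kernel W of
    x |-> (phi (f^j x))_(j < n). It is invariant because f^n = 0 on U;
    interpolation by vectors of the chain shows both that the chain and W span U
    and that the codimension of W is n. *)
Lemma split_chain (U : {vspace V}) n u :
    invariant_vs f U -> u \in U -> phi (iter n.-1 f u) != 0 ->
    {in U, forall x, iter n f x = 0} ->
  exists W : {vspace V}, [/\ invariant_vs f W,
    (U <= <<traject f u n>> + W)%VS, (W <= U)%VS & \dim U = (n + \dim W)%N].
Proof.
move=> invU Uu phi_u fn0; pose Phi := linfun (orbit_values n).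
have PhiE x j : Phi x 0 j = phi (iter j f x) by rewrite lfunE mxE.
have memWP x : reflect (x \in U /\ forall j, (j < n)%N -> phi (iter j f x) = 0)
    (x \in (U :&: lker Phi)%VS).
  rewrite memv_cap memv_ker; apply: (iffP andP) => -[Ux x0]; split=> //.
    by move=> j lt_j; rewrite -(PhiE x (Ordinal lt_j)) (eqP x0) mxE.
  by apply/eqP/rowP => j; rewrite PhiE x0 // mxE.
have chain_U : (<<traject f u n>> <= U)%VS.
  by apply/span_subvP => _ /trajectP[j _ ->]; apply: mem_iter.
exists (U :&: lker Phi)%VS; split; last 1 first.
- rewrite -(limg_ker_dim Phi U) addnC; congr (_ + _)%N.
  have -> : (Phi @: U = fullv)%VS; last by rewrite dimvf /dim /= mul1n.
  apply/eqP; rewrite eqEsubv subvf; apply/subvP => v _.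
  have [y uy yr] := orbit_interpolation (fun j => if insub j is Some i then v 0 i else 0) phi_u (fn0 _ Uu).
  apply/memv_imgP; exists y; first exact: (subvP chain_U).
  by apply/rowP => j; rewrite PhiE yr // insubT //= => lt_j; congr (v _ _); apply: val_inj.
- apply/invariantP => x /memWP[Ux x0]; apply/memWP; split.
    exact: (mem_iter 1 invU).
  move=> j lt_j; rewrite -iterSr; have [/x0//|le_n] := ltnP j.+1 n.
  by rewrite (iter_eq0_le (fn0 _ Ux) le_n) linear0.
- apply/subvP => x Ux.
  have [y uy yr] := orbit_interpolation (fun j => phi (iter j f x)) phi_u (fn0 _ Uu).
  rewrite -(subrK y x) addrC memv_add //; apply/memWP; split.
    by rewrite rpredB // (subvP chain_U).
  by move=> j lt_j; rewrite iter_subv linearB /= yr // subrr.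
- exact: capvSl.
Qed.

End SplitChain.

(** Split off a chain whose length n is the nilpotency index on U, and recurse
    in the complement. The equality of dimensions replaces the linear
    independence of the chains. *)
Lemma chain_decomposition (K : fieldType) (V : vectType K) (f : 'End(V))
    (U : {vspace V}) : nilpotent_end f -> invariant_vs f U ->
  exists s : seq (V * nat),
    [/\ {in s, forall c, (0 < c.2)%N /\ iter c.2 f c.1 = 0},
        (U <= \sum_(c <- s) <<traject f c.1 c.2>>)%VS &
        \dim U = (\sum_(c <- s) c.2)%N].
Proof.
move=> [N fN0]; have [d] := ubnP (\dim U); elim: d U => // d IH U le_d invU.
have [->|U0] := eqVneq U 0%VS.
  by exists [::]; split; rewrite ?big_nil ?dimv0 ?sub0v.
have ex_n : exists n, (pow_end f n @: U == 0)%VS.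
  exists N; rewrite -lkerE; apply/subvP => x _.
  by rewrite memv_ker pow_endE fN0.
have [n] := ex_minnP ex_n; rewrite -lkerE => /subvP Un n_min.
have fn0 : {in U, forall x, iter n f x = 0}.
  by move=> x /Un; rewrite memv_ker pow_endE => /eqP.
have n_gt0 : (0 < n)%N.
  rewrite lt0n; apply: contraNneq U0 => n0; rewrite -subv0; apply/subvP => x Ux.
  by have := fn0 x Ux; rewrite n0 /= => ->; apply: mem0v.
have [u Uu fu] : exists2 u, u \in U & iter n.-1 f u != 0.
  have /subvPn[u Uu] : ~~ (U <= lker (pow_end f n.-1))%VS.
    by rewrite lkerE; apply/negP => /n_min; rewrite leqNgt prednK ?leqnn.
  by rewrite memv_ker pow_endE; exists u.
have [phi phi_u] := functional_nonzero fu.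
have [W [invW UW WU dimU]] := split_chain invU Uu phi_u fn0.
have [|s [s_ok Ws dimW]] := IH W _ invW.
  by rewrite -ltnS; apply: leq_trans le_d; rewrite dimU ltnS -addn1 addnC leq_add2r.
exists ((u, n) :: s); split.
- by move=> c; rewrite inE => /predU1P[->|/s_ok //]; split=> //; apply: fn0.
- by rewrite big_cons; apply: subv_trans UW _; apply: addvS.
- by rewrite big_cons -dimW.
Qed.

(** The tuple lists each chain from its last nonzero vector to its generator, in
    agreement with the position of the ones above the diagonal of a Jordan
    block. It spans V and has dim V entries, hence is a basis. *)
Lemma jordan_form_exists (K : fieldType) (V : vectType K) (f : 'End(V)) :
  nilpotent_end f ->
  exists k (p : 'I_k -> nat), has_jordan_form f (fun=> 0) p.
Proof.
move=> nilp; have inv_full : invariant_vs f fullv by apply: subvf.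
have [s [s_ok full_s dim_s]] := chain_decomposition nilp inv_full.
pose c (i : 'I_(size s)) := tnth (in_tuple s) i.
have c_ok i : (0 < (c i).2)%N /\ iter (c i).2 f (c i).1 = 0 by apply: s_ok; apply: mem_tnth.
pose p i := (c i).2; exists (size s), p; split=> [i|]; first by case: (c_ok i).
pose G (t : {i : 'I_(size s) & 'I_(p i)}) := iter (rev_ord (tagged t)) f (c (tag t)).1.
pose e := [tuple G (tagnat.sig t) | t < \sum_(i < size s) p i].
have eE i (j : 'I_(p i)) : e`_(tagnat.Rank _ j) = iter (rev_ord j) f (c i).1.
  rewrite -tnth_nth tnth_mktuple.
  by rewrite /tagnat.Rank tagnat.rankK.
exists e; split.
  rewrite basisEdim size_tuple dim_s big_tnth leqnn andbT.
  apply: subv_trans full_s _; rewrite big_tnth; apply/subv_sumP => i _.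
  apply/span_subvP => _ /trajectP[j lt_j ->].
  have lt_jp : (j < p i)%N := lt_j.
  have -> : iter j f (tnth (in_tuple s) i).1 = e`_(tagnat.Rank i (rev_ord (Ordinal lt_jp))).
    by rewrite eE rev_ordK.
  by apply: memv_span; rewrite mem_nth ?size_tuple.
apply/represents_jordanP => i j; rewrite scale0r add0r eE -iterS.
have [c_gt0 fc0] := c_ok i; rewrite (eq_bigr _ (fun j' _ => eE i j')).
have [j0|j_gt0] := posnP j.
  rewrite big_pred0 => [|j']; last by rewrite j0.
  by have -> : (rev_ord j).+1 = (c i).2 by rewrite /= j0 subn1 prednK.
have lt_j : (j.-1 < p i)%N by apply: leq_ltn_trans (leq_pred j) (ltn_ord j).
rewrite (big_pred1 (Ordinal lt_j)) /= => [|j'].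
  by rewrite -iterS; congr (iter _ f _); have := ltn_ord j; lia.
by rewrite -{1}(prednK j_gt0) eqSS.
Qed.

(** * The equivalence *)

Unset Implicit Arguments.

Theorem theorem1p2 (V : vectType 'F_2) (f : 'End(V)) (hf : nilpotent_end f) :
  (exists X : {vspace V}, characteristic_vs f X /\ ~ hyperinvariant_vs f X) <->
  (exists r s : nat, [/\ (0 < r)%N, (r + 1 < s)%N &
     exists (k : nat) (a : 'I_k -> 'F_2) (p : 'I_k -> nat),
       [/\ has_jordan_form f a p,
           #|[set i | p i == s]| = 1%N &
           #|[set i | p i == r]| = 1%N]]).
Proof.
split=> [[X [charX not_hyper]]|[r [s [_ lt_rs [k [a [p [form_p one_s one_r]]]]]]]]; last first.
  have [u gens] := jordan_form_generators hf form_p.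
  have [l ps sole_l] := sole_size_witness one_s.
  have [i pr sole_i] := sole_size_witness one_r.
  by apply: (not_hyperinvariant_exists gens sole_i sole_l); rewrite ps pr.
have [k [p form_p]] := jordan_form_exists hf; have [u gens] := jordan_form_generators hf form_p.
have [/existsP[i /existsP[l /and3P[sole_i sole_l lt_il]]]|/existsPn no_gap] :=
    boolP [exists i, exists l, [&& sole_size p (p i), sole_size p (p l) & (p i + 1 < p l)%N]].
  exists (p i), (p l); split=> //; first by case: form_p.
  by exists k, (fun=> 0), p; split=> //; apply/eqP.
case: not_hyper; apply: (characteristic_hyperinvariant gens _ charX) => i l sole_i sole_l.
have /existsPn/(_ l) := no_gap i.
by rewrite sole_i sole_l /= -leqNgt addn1.
Qed.
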